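(* Let $\mathcal{M}=(M_1,\dots,M_k)$ be a flag matroid on $[n]$. The flag matroid polytope $P(\mathcal{M})$ is an MV polytope if and only if $P(M_i)$ is an MV polytope for every $i=1,\dots,k$.
   Context: Write $e_1,\dots,e_n$ for the standard basis of $\mathbb{R}^n$ and $e_S=\sum_{i\in S}e_i$. The matroid polytope of a matroid $M$ on $[n]$ with set of bases $\mathcal{B}(M)$ is $P(M)=\operatorname{conv}(e_B : B\in\mathcal{B}(M))$, and its rank function is $\mu_M(S)=\max_{B\in\mathcal{B}(M)}|S\cap B|$. Let $M,N$ be matroids on $[n]$ with the rank of $M$ greater than the rank of $N$. $N$ is a matroid quotient of $M$, written $M\twoheadrightarrow N$, if $\mu_M(B)-\mu_M(A)\ge\mu_N(B)-\mu_N(A)$ for all $A\subseteq B\subseteq[n]$. A flag matroid on $[n]$ is a sequence $\mathcal{M}=(M_1,\dots,M_k)$ of matroids on $[n]$ with $M_k\twoheadrightarrow M_{k-1}\twoheadrightarrow\cdots\twoheadrightarrow M_1$. Its flag matroid polytope is the Minkowski sum $P(\mathcal{M})=P(M_1)+\cdots+P(M_k)$. A generalized permutahedron on $[n]$ is a polytope $P\subseteq\mathbb{R}^n$ such that every edge of $P$ is parallel to a vector $e_i-e_j$ with $i\neq j$ (points are allowed). It is a lattice generalized permutahedron if all its vertices lie in $\mathbb{Z}^n$. Its supermodular function is $\mu^P(S)=\min_{x\in P}\sum_{i\in S}x_i$ for $S\subseteq[n]$. A lattice generalized permutahedron $P$ is a Mirković–Vilonen (MV) polytope on $[n]$ if for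 all $S\subseteq[n]$ and all $a<b<c$ in $[n]\setminus S$, $$\mu^P(S\cup\{b\})+\mu^P(S\cup\{a,c\})=\min\bigl(\mu^P(S\cup\{a\})+\mu^P(S\cup\{b,c\}),\ \mu^P(S\cup\{a,b\})+\mu^P(S\cup\{c\})\bigr).$$ *)

(* Defs.v *)
From HB Require Import structures.
From mathcomp Require Import all_boot all_order all_algebra.
From mathcomp Require Import boolp classical_sets cardinality reals convex.

Set Implicit Arguments.
Unset Strict Implicit.
Unset Printing Implicit Defensive.

Import Order.TTheory GRing.Theory Num.Theory.

Local Open Scope ring_scope.

(* The ground set [n] = {1, ..., n} is 'I_n = {0, ..., n-1}. *)
Record matroid (n : nat) := Matroid {
  bases : {set {set 'I_n}};
  bases_neq0 : bases != finset.set0;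
  bases_exchange : forall A B : {set 'I_n}, A \in bases -> B \in bases ->
    forall x, x \in A :\: B ->
      exists2 y, y \in B :\: A & (y |: (A :\ x)) \in bases }.

Definition mrank (n : nat) (M : matroid n) (S : {set 'I_n}) : nat :=
  (\max_(B in bases M) #|S :&: B|)%N.

(* The rank inequality is written mu_N(B) + mu_M(A) <= mu_M(B) + mu_N(A) to
   avoid the truncated subtraction of nat. *)
Definition mquotient (n : nat) (M N : matroid n) : Prop :=
  (mrank N [set: 'I_n]%SET < mrank M [set: 'I_n]%SET)%N /\
  forall A B : {set 'I_n}, A \subset B ->
    (mrank N B + mrank M A <= mrank M B + mrank N A)%N.

Definition flag_matroid (n k : nat) (M : 'I_k -> matroid n) : Prop :=
  forall i j : 'I_k, j = i.+1 :> nat -> mquotient (M j) (M i).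

Definition convex_hull (R : realType) (n : nat) (A : set 'rV[R]_n) : set 'rV[R]_n :=
  smallest (@convex_set R 'rV[R]_n) A.

Definition polytope (R : realType) (n : nat) (P : set 'rV[R]_n) : Prop :=
  exists V : set 'rV[R]_n,
    [/\ finite_set V, (V !=set0)%classic & P = convex_hull V].

Definition is_face (R : realType) (n : nat) (P F : set 'rV[R]_n) : Prop :=
  exists (c : 'rV[R]_n) (m : R),
    (forall x, P x -> m <= \sum_i c 0 i * x 0 i) /\
    F = [set x | P x /\ \sum_i c 0 i * x 0 i = m]%classic.

Definition is_vertex (R : realType) (n : nat) (P : set 'rV[R]_n)
    (v : 'rV[R]_n) : Prop :=
  is_face P [set v]%classic.

(* A one-dimensional face of a polytope, given by its two endpoints. *)
Definition is_edge (R : realType) (n : nat) (P : set 'rV[R]_n)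
    (u v : 'rV[R]_n) : Prop :=
  u <> v /\ is_face P (convex_hull [set u; v]%classic).

Definition std (R : realType) (n : nat) (i : 'I_n) : 'rV[R]_n := delta_mx 0 i.

Definition generalized_permutahedron (R : realType) (n : nat)
    (P : set 'rV[R]_n) : Prop :=
  polytope P /\
  forall u v, is_edge P u v ->
    exists (i j : 'I_n) (t : R), i != j /\ v - u = t *: (std R i - std R j).

Definition lattice_gp (R : realType) (n : nat) (P : set 'rV[R]_n) : Prop :=
  generalized_permutahedron P /\
  forall v, is_vertex P v -> forall i, v 0 i \is a Num.int.

(* The least element of A, and 0 if there is none (which does not happen for
   a linear form on a nonempty polytope). *)
Definition minimum (R : realType) (A : set R) : R :=
  xget 0 (A `&` lbound A)%classic.

Definition supermod (R : realType) (n : nat) (P : set 'rV[R]_n)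
    (S : {set 'I_n}) : R :=
  minimum [set \sum_(i in S) x 0 i | x in P]%classic.

Definition mv_polytope (R : realType) (n : nat) (P : set 'rV[R]_n) : Prop :=
  lattice_gp P /\
  forall (S : {set 'I_n}) (a b c : 'I_n),
    a \notin S -> b \notin S -> c \notin S -> (a < b)%N -> (b < c)%N ->
    supermod P (S :|: [set b])%SET + supermod P (S :|: [set a; c])%SET =
    Num.min
      (supermod P (S :|: [set a])%SET + supermod P (S :|: [set b; c])%SET)
      (supermod P (S :|: [set a; b])%SET + supermod P (S :|: [set c])%SET).

Definition std_sum (R : realType) (n : nat) (S : {set 'I_n}) : 'rV[R]_n :=
  \sum_(i in S) std R i.

Definition matroid_polytope (R : realType) (n : nat) (M : matroid n) :
    set 'rV[R]_n :=
  convex_hull [set std_sum R B | B in [set B | B \in bases M]]%classic.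

Arguments matroid_polytope R {n} M.

Definition minkowski_sum (R : realType) (n k : nat)
    (P : 'I_k -> set 'rV[R]_n) : set 'rV[R]_n :=
  [set \sum_i x i | x in [set x : 'I_k -> 'rV[R]_n | forall i, P i (x i)]]%classic.

Definition flag_matroid_polytope (R : realType) (n k : nat)
    (M : 'I_k -> matroid n) : set 'rV[R]_n :=
  minkowski_sum (fun i => matroid_polytope R (M i)).

Arguments flag_matroid_polytope R {n k} M.

(* Main.v *)
Require Import Defs.
From mathcomp Require Import boolp classical_sets cardinality convex interval_inference.
From mathcomp Require Import all_boot all_order all_algebra.
From mathcomp Require Import reals.
From mathcomp Require Import zify ring lra.

(* The supermodular function of a Minkowski sum is the sum of those of the
   summands, and that of a matroid polytope is S |-> r([n]) - r([n] \ S).  Let D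
   be the complement of S + a + b + c.  The MV condition says that
     X = r(D+b) + r(D+a+c)  is the larger of
     Y = r(D+a) + r(D+b+c)  and  Z = r(D+c) + r(D+a+b).
   For one matroid the maximum of X, Y, Z is always attained twice.  For a
   quotient M ->> N it cannot be that Y < X in one of the two and Z < X in the
   other; so along a flag either X <= Y throughout or X <= Z throughout, and then the condition for the sums is the condition for each
   summand.  That these polytopes are lattice generalized permutahedra follows
   from basis exchange among the bases minimizing a linear form. *)

Import Order.TTheory GRing.Theory Num.Theory.

Set Implicit Arguments.
Unset Strict Implicit.
Unset Printing Implicit Defensive.

(** * Bases and rank function of a matroid *)

Lemma card_exchange (T : finType) (A : {set T}) (x y : T) :
  x \in A -> y \notin A -> #|y |: (A :\ x)| = #|A|.
Proof. by move=> xA yA; rewrite cardsU1 !inE (negbTE yA) andbF [RHS](cardsD1 x) xA. Qed.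

(** The measure that decreases when one basis is moved towards another by exchanges. *)
Lemma exchange_closer (T : finType) (A B : {set T}) (x y : T) :
  x \in A :\: B -> y \in B -> #|(y |: (A :\ x)) :\: B| < #|A :\: B|.
Proof.
move=> xAB yB; rewrite [X in _ < X](cardsD1 x) xAB add1n ltnS subset_leq_card //.
apply/subsetP => z; rewrite !inE => /andP[zB /orP[/eqP zy|/andP[-> ->]]].
  by rewrite zy yB in zB.
by rewrite zB.
Qed.

(** Exchanging elements of [A] for elements of [B] keeps the cardinality and ends with a basis
    inside [B]. *)
Lemma leq_card_bases n (M : matroid n) (A B : {set 'I_n}) :
  A \in bases M -> B \in bases M -> #|A| <= #|B|.
Proof.
move=> + BM; have [m] := ubnP #|A :\: B|; elim: m A => // m IHm A ltm AM.
have [/eqP|[x xAB]] := set_0Vmem (A :\: B).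
  by rewrite setD_eq0 => /subset_leq_card.
have [y] := bases_exchange AM BM xAB; rewrite inE => /andP[yA yB] AM'.
have xA : x \in A by move: xAB; rewrite inE => /andP[].
rewrite -(card_exchange xA yA); apply: IHm AM'.
by have := exchange_closer xAB yB; lia.
Qed.

Lemma card_bases n (M : matroid n) (A B : {set 'I_n}) :
  A \in bases M -> B \in bases M -> #|A| = #|B|.
Proof. by move=> AM BM; apply/eqP; rewrite eqn_leq !(@leq_card_bases _ M). Qed.

Lemma mrank_attained n (M : matroid n) (S : {set 'I_n}) :
  exists2 B, B \in bases M & mrank M S = #|S :&: B|.
Proof.
have := bases_neq0 M; rewrite -card_gt0.
by move/(eq_bigmax_cond (fun B : {set 'I_n} => #|S :&: B|)) => [B]; exists B.
Qed.

Lemma leq_mrank n (M : matroid n) (S B : {set 'I_n}) :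
  B \in bases M -> #|S :&: B| <= mrank M S.
Proof. exact: (leq_bigmax_cond (F := fun B : {set 'I_n} => #|S :&: B|)). Qed.

Lemma mrankS n (M : matroid n) (S T : {set 'I_n}) :
  S \subset T -> mrank M S <= mrank M T.
Proof.
move=> ST; have [B BM ->] := mrank_attained M S.
by apply: leq_trans (leq_mrank T BM); rewrite subset_leq_card ?setSI.
Qed.

Lemma mrankU1 n (M : matroid n) (S : {set 'I_n}) x :
  mrank M (S :|: [set x]) <= (mrank M S).+1.
Proof.
have [B BM ->] := mrank_attained M (S :|: [set x]).
rewrite setIUl (leq_trans (leq_card_setU _ _)) // -addn1 leq_add ?leq_mrank //.
by rewrite -(cards1 x) subset_leq_card ?subsetIl.
Qed.

(** Start from a basis optimal for [S] and move it towards one optimal for [T]. Each exchange throws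
    out an element outside [T], hence outside [S], so optimality for [S] survives. *)
Lemma mrank_attained2 n (M : matroid n) (S T : {set 'I_n}) : S \subset T ->
  exists2 B, B \in bases M & mrank M S = #|S :&: B| /\ mrank M T = #|T :&: B|.
Proof.
move=> ST; have [B BM rT] := mrank_attained M T.
have [A AM rS] := mrank_attained M S.
have [m] := ubnP #|A :\: B|; elim: m A AM rS => // m IHm A AM rS ltm.
have [TAB|TAB] := leqP #|T :&: B| #|T :&: A|.
  exists A => //; split=> //; apply/eqP.
  by rewrite eqn_leq leq_mrank // rT TAB.
(* A and B are equicardinal, so A has more elements than B outside T. *)
have [x] : exists x, x \in (A :\: B) :\: T.
  apply/set0Pn; rewrite -card_gt0; have := card_bases AM BM.
  rewrite -(cardsID T A) -(cardsID T B) (setIC A) (setIC B) => eqAB.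
  have ltD : #|B :\: T| < #|A :\: T| by lia.
  have : ~~ (A :\: T \subset B :\: T).
    by apply/negP => /subset_leq_card; rewrite leqNgt ltD.
  rewrite card_gt0; apply: contra => /eqP AT0; apply/subsetP => z zAT.
  by have := in_set0 z; rewrite -AT0; move: zAT; rewrite !inE; do 3!case: (_ \in _).
rewrite inE => /andP[xT xAB].
have [y] := bases_exchange AM BM xAB; rewrite inE => /andP[yA yB] AM'.
apply: (IHm _ AM'); last by have := exchange_closer xAB yB; lia.
apply/eqP; rewrite eqn_leq leq_mrank // andbT rS subset_leq_card //.
apply/subsetP => z; rewrite !inE => /andP[zS zA]; rewrite zS zA andbT /=.
by apply/orP; right; apply: contraNneq xT => <-; exact: (subsetP ST).
Qed.

(** A single basis attains the ranks of both [A :&: B] and [A :|: B], and cardinality is modular on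
    its traces. [D] enters by monotonicity. *)
Lemma mrank_submod n (M : matroid n) (D A B : {set 'I_n}) :
  D \subset A -> D \subset B ->
  mrank M (A :|: B) + mrank M D <= mrank M A + mrank M B.
Proof.
move=> DA DB.
have [C CM [rI rU]] : exists2 C, C \in bases M &
    mrank M (A :&: B) = #|(A :&: B) :&: C| /\ mrank M (A :|: B) = #|(A :|: B) :&: C|.
  by apply: mrank_attained2; rewrite (subset_trans (subsetIl _ _)) ?subsetUl.
apply: (@leq_trans (mrank M (A :|: B) + mrank M (A :&: B))).
  by rewrite leq_add2l mrankS // subsetI DA.
rewrite rI rU setIUl setIIl cardsUI.
by rewrite leq_add ?leq_mrank.
Qed.

Lemma mrank_submod1 n (M : matroid n) (D : {set 'I_n}) (x y : 'I_n) :
  mrank M (D :|: [set x; y]) + mrank M D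
    <= mrank M (D :|: [set x]) + mrank M (D :|: [set y]).
Proof. by rewrite setUUr mrank_submod ?subsetUl. Qed.

(** * Three-term rank sums, in one matroid and along a flag *)

Definition mrank_split n (M : matroid n) (D : {set 'I_n}) (x y z : 'I_n) : nat :=
  mrank M (D :|: [set x]) + mrank M (D :|: [set y; z]).

Lemma mrank_splitC n (M : matroid n) (D : {set 'I_n}) (x y z : 'I_n) :
  mrank_split M D x y z = mrank_split M D x z y.
Proof. by rewrite /mrank_split (setUC [set y]). Qed.

(* The values of the rank function on D, D + x, D + y and D + x + y. *)
Definition diamond (p q r s : nat) :=
  [/\ p <= q, q <= p.+1, p <= r & r <= p.+1] /\
  [/\ q <= s, s <= q.+1, r <= s, s <= r.+1 & s + p <= q + r].

Lemma mrank_diamond n (M : matroid n) (D : {set 'I_n}) (x y : 'I_n) :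
  diamond (mrank M D) (mrank M (D :|: [set x])) (mrank M (D :|: [set y]))
    (mrank M (D :|: [set x; y])).
Proof.
have xy : D :|: [set x; y] = D :|: [set x] :|: [set y] by rewrite setUA.
have yx : D :|: [set x; y] = D :|: [set y] :|: [set x].
  by rewrite -setUA [[set y; x]]setUC.
split; split; try exact: mrankU1; try exact: mrank_submod1;
  try exact/mrankS/subsetUl.
- by rewrite xy mrankS ?subsetUl.
- by rewrite xy mrankU1.
- by rewrite yx mrankS ?subsetUl.
- by rewrite yx mrankU1.
Qed.

(** These are the six square faces of the cube of sets between [D] and [D] with [a], [b], [c] added.
    With them, rank statements about three elements become linear arithmetic. *)
Lemma mrank_diamonds n (M : matroid n) (D : {set 'I_n}) (a b c : 'I_n) :
  let r A := mrank M (D :|: A) in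
  [/\ diamond (mrank M D) (r [set a]) (r [set b]) (r [set a; b]),
      diamond (mrank M D) (r [set a]) (r [set c]) (r [set a; c]) &
      diamond (mrank M D) (r [set b]) (r [set c]) (r [set b; c])] /\
  [/\ diamond (r [set a]) (r [set a; b]) (r [set a; c]) (r [set a; b; c]),
      diamond (r [set b]) (r [set a; b]) (r [set b; c]) (r [set a; b; c]) &
      diamond (r [set c]) (r [set a; c]) (r [set b; c]) (r [set a; b; c])].
Proof.
split; first by split; apply: mrank_diamond.
split.
- by have := mrank_diamond M (D :|: [set a]) b c; rewrite -!setUA.
- have := mrank_diamond M (D :|: [set b]) a c.
  by rewrite -!setUA (setUC [set b] [set a]) (setUCA [set b] [set a]).
- have := mrank_diamond M (D :|: [set c]) a b; rewrite -!setUA.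
  by rewrite (setUC [set c] [set a]) (setUCA [set c] [set a]) (setUC [set c] [set b]).
Qed.

(** Contract [D], which shifts all three sums by the same constant. If one of the elements is a
    loop, two of the sums equal the sum of the ranks of the other two elements, and the third is at
    most that by submodularity. Otherwise each sum is one plus the rank of a pair, and since
    parallelism is transitive, it cannot be that exactly one pair has rank 2. *)
Lemma mrank_split_max_twice n (M : matroid n) (D : {set 'I_n}) (a b c : 'I_n) :
  let X := mrank_split M D b a c in
  let Y := mrank_split M D a b c in
  let Z := mrank_split M D c a b in
  [\/ X = Y /\ Z <= X, X = Z /\ Y <= X | Y = Z /\ X <= Y].
Proof.
rewrite /mrank_split /=.
have [] := mrank_diamonds M D a b c.
do 2![case; do 3![move=> [[? ? ? ?] [? ? ? ? ?]]]].
set X := mrank _ _ + _; set Y := mrank _ _ + _; set Z := mrank _ _ + _.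
have [ltXY|ltYX|eXY] := ltngtP X Y.
- by apply: Or33; rewrite /X /Y /Z in ltXY *; lia.
- by apply: Or32; rewrite /X /Y /Z in ltYX *; lia.
- by apply: Or31; rewrite /X /Y /Z in eXY *; lia.
Qed.

(** Without the strict fall in rank of [mquotient] the relation is reflexive, so that it covers any
    two members of a flag, equal ones included. *)
Definition weak_quotient n (M N : matroid n) := forall A B : {set 'I_n},
  A \subset B -> mrank N B + mrank M A <= mrank M B + mrank N A.

(** Contract [D]. The hypothesis says that in [M] the element [c] lies in the closure of [b] but not
    in that of [a], so [b] and [c] are parallel non-loops. A quotient preserves membership in
    closures, hence [b] and [c] have the same closure in [N], and there the two sums compared are
    equal. *)
Lemma weak_quotient_split n (M N : matroid n) (D : {set 'I_n}) (a b c : 'I_n) :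
  weak_quotient M N ->
  mrank_split M D a b c < mrank_split M D b a c ->
  mrank_split N D b a c <= mrank_split N D c a b.
Proof.
move=> q; rewrite /mrank_split.
have [] := mrank_diamonds M D a b c.
do 2![case; do 3![move=> [[? ? ? ?] [? ? ? ? ?]]]].
have [] := mrank_diamonds N D a b c.
do 2![case; do 3![move=> [[? ? ? ?] [? ? ? ? ?]]]].
have q1 := q _ _ (setUS D (subsetUl [set a] [set b])).
have q2 := q _ _ (setUS D (subsetUr [set a] [set b])).
have q3 := q _ _ (setUS D (subsetUl [set b] [set c])).
have q4 := q _ _ (setUS D (subsetUr [set b] [set c])).
have q5 := q _ _ (setUS D (subsetUl [set a] [set c])).
have q6 := q _ _ (setUS D (subsetUr [set a] [set c])).
lia.
Qed.

Lemma flag_weak_quotient n k (M : 'I_k -> matroid n) (i j : 'I_k) :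
  flag_matroid M -> i <= j -> weak_quotient (M j) (M i).
Proof.
move=> fM; move: {2}(j - i) (erefl (j - i)) => d.
elim: d j => [|d IHd] j ji leij A B AB.
  have -> : i = j by apply: val_inj => /=; lia.
  by rewrite addnC.
have ltj : j.-1 < k by have := ltn_ord j; lia.
pose j' := Ordinal ltj.
have := IHd j' _ _ A B AB; rewrite /j' /=.
have [_ /(_ A B AB)] := fM j' j ltac:(by rewrite /j' /=; lia).
rewrite /j' => h1 /(_ ltac:(lia) ltac:(lia)) h2.
lia.
Qed.

Lemma flag_split n k (M : 'I_k -> matroid n) (i j : 'I_k)
    (D : {set 'I_n}) (a b c : 'I_n) :
  flag_matroid M ->
  mrank_split (M i) D a b c < mrank_split (M i) D b a c ->
  mrank_split (M j) D b a c <= mrank_split (M j) D c a b.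
Proof.
move=> fM ltYX; have [leij|/ltnW leji] := leqP j i.
  exact: weak_quotient_split (flag_weak_quotient fM leij) ltYX.
(* Here the quotient goes from [M j] to [M i]. Swapping [a] and [c] keeps X and exchanges Y with Z,
   so the contrapositive is again an instance of [weak_quotient_split]. *)
rewrite leqNgt; apply/negP => ltZX; move: ltYX; apply/negP; rewrite -leqNgt.
rewrite (mrank_splitC _ _ b) (mrank_splitC _ _ a).
apply: (weak_quotient_split (flag_weak_quotient fM leji)).
by rewrite (mrank_splitC _ _ b) (mrank_splitC _ _ c).
Qed.

(** The second hypothesis puts either every [x i] below [y i] or every [x i] below [z i]. In the
    first case the sum condition squeezes the sums of [x] and [y] together, which forces [x i = y i]
    term by term, and the first hypothesis then gives [z i <= x i]. Conversely, these termwise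
    relations add up. *)
Lemma sum_max_iff k (x y z : 'I_k -> nat) :
  (forall i, [\/ x i = y i /\ z i <= x i, x i = z i /\ y i <= x i
                | y i = z i /\ x i <= y i]) ->
  (forall i j, y i < x i -> x j <= z j) ->
  \sum_i x i = maxn (\sum_i y i) (\sum_i z i) <->
  forall i, x i = maxn (y i) (z i).
Proof.
move=> twice key.
have {}key : (forall i, x i <= y i) \/ (forall i, x i <= z i).
  have [/forallP|] := boolP [forall i, x i <= y i]; first by left.
  rewrite negb_forall => /existsP[i]; rewrite -ltnNge => lti; right=> j.
  exact: key lti.
split=> [sum_x i|eqx].
  have eq_term (u : 'I_k -> nat) : (forall j, x j <= u j) ->
      \sum_j u j <= \sum_j x j -> x i = u i.
    move=> lexu; rewrite (bigD1 i) //= [X in _ <= X](bigD1 i) //=.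
    have : \sum_(j | j != i) x j <= \sum_(j | j != i) u j by apply: leq_sum.
    by move: (lexu i) (\sum_(j | _) x j) (\sum_(j | _) u j); lia.
  have := twice i.
  case: key => /eq_term-> //; rewrite ?sum_x ?leq_maxl ?leq_maxr //.
    by case=> -[]; lia.
  by case=> -[]; lia.
case: key => [lexy|lexz].
  have exy i : x i = y i by have := lexy i; have := eqx i; lia.
  rewrite (eq_bigr _ (fun i _ => exy i)); apply/esym/maxn_idPl/leq_sum => i _.
  by have := eqx i; have := exy i; lia.
have exz i : x i = z i by have := lexz i; have := eqx i; lia.
rewrite (eq_bigr _ (fun i _ => exz i)); apply/esym/maxn_idPr/leq_sum => i _.
by have := eqx i; have := exz i; lia.
Qed.

Local Open Scope ring_scope.

(** * Convex hulls and linear forms *)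

Section Hull.
Variables (R : realType) (n : nat).
Implicit Types (A C : set 'rV[R]_n) (x y c : 'rV[R]_n).

(** [convex_set] takes weights bundled with their bounds; here the weight is a plain real. *)
Lemma convex_setP C : convex_set C <->
  forall x y (t : R), 0 <= t <= 1 -> C x -> C y -> C (t *: x + (1 - t) *: y).
Proof.
split=> [cC x y t /andP[t0 t1] Cx Cy|cC x y l /set_mem Cx /set_mem Cy].
  have := cC x y (Itv01 t0 t1) (mem_set Cx) (mem_set Cy).
  by move/set_mem.
by apply/mem_set/cC => //; rewrite ge0 le1.
Qed.

Lemma convex_hull_sub A C : convex_set C -> (A `<=` C)%classic ->
  (convex_hull A `<=` C)%classic.
Proof. exact: smallest_sub. Qed.

Lemma sub_convex_hull A : (A `<=` convex_hull A)%classic.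
Proof. exact: sub_gen_smallest. Qed.

Lemma convex_convex_hull A : convex_set (convex_hull A).
Proof.
apply/convex_setP => x y t t01 Ax Ay C [cC AC].
by apply: (convex_setP C).1 => //; [apply: Ax|apply: Ay].
Qed.

Definition dot c x : R := \sum_i c 0 i * x 0 i.

Lemma dotD c x y : dot c (x + y) = dot c x + dot c y.
Proof. by rewrite -big_split; apply: eq_bigr => i _; rewrite mxE mulrDr. Qed.

Lemma dotZ c t x : dot c (t *: x) = t * dot c x.
Proof. by rewrite mulr_sumr; apply: eq_bigr => i _; rewrite mxE mulrCA. Qed.

Lemma dot_sum c (I : finType) (P : pred I) (x : I -> 'rV[R]_n) :
  dot c (\sum_(i | P i) x i) = \sum_(i | P i) dot c (x i).
Proof.
rewrite exchange_big /=; apply: eq_bigr => i _.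
by rewrite summxE mulr_sumr.
Qed.

Lemma dot_std_sum c (B : {set 'I_n}) :
  dot c (std_sum R B) = \sum_(i in B) c 0 i.
Proof.
rewrite dot_sum; apply: eq_bigr => i _; rewrite /dot (bigD1 i) //=.
rewrite big1 => [|j ji]; rewrite mxE eqxx /= ?(negbTE ji) ?mulr0 //.
by rewrite eqxx mulr1 addr0.
Qed.

Lemma std_inj : injective (@std R n).
Proof.
move=> i j /matrixP/(_ 0 j); rewrite !mxE !eqxx /=.
by case: eqVneq => // _ /esym/eqP; rewrite oner_eq0.
Qed.

Lemma std_sum_exchange (A : {set 'I_n}) (x y : 'I_n) : x \in A -> y \notin A ->
  std_sum R (y |: (A :\ x)) - std_sum R A = std R y - std R x.
Proof.
move=> xA yA; rewrite /std_sum big_setU1 ?inE ?(negbTE yA) ?andbF //=.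
by rewrite (big_setD1 x xA) /= opprD addrACA subrr addr0.
Qed.

Lemma std_sum_int (B : {set 'I_n}) j : std_sum R B 0 j \is a Num.int.
Proof. by rewrite /std_sum summxE rpred_sum // => i _; rewrite mxE rpred_nat. Qed.

Lemma convex_dot_ge c m : convex_set ([set x | m <= dot c x]%classic : set 'rV[R]_n).
Proof.
apply/convex_setP => x y t /andP[t0 t1] /= mx my; rewrite dotD !dotZ; nra.
Qed.

(** Records the line through [u] and [v]: an edge matters below through its direction. *)
Lemma convex_hull2 (u v x : 'rV[R]_n) :
  convex_hull [set u; v]%classic x -> exists t, x = u + t *: (v - u).
Proof.
apply: (@convex_hull_sub _ [set x | exists t, x = u + t *: (v - u)]%classic).
  apply/convex_setP => _ _ t _ [s ->] [r ->]; exists (t * s + (1 - t) * r).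
  by apply/rowP => j; rewrite !mxE; ring.
by move=> _ [->|->]; [exists 0|exists 1]; rewrite ?scale0r ?addr0 // scale1r addrC subrK.
Qed.
End Hull.

(** * Bases minimizing a linear form *)

Section MinBasis.
Variables (R : realType) (n : nat).
Implicit Types (c : 'rV[R]_n) (M : matroid n).

(** These bases give the vertices of the face of the matroid polytope on which [c] is minimal. *)
Definition min_basis c M (A : {set 'I_n}) := A \in bases M /\
  forall B, B \in bases M -> dot c (std_sum R A) <= dot c (std_sum R B).

Lemma min_basis_exists c M : exists A, min_basis c M A.
Proof.
have /set0Pn[B BM] := bases_neq0 M.
case: (arg_minP (fun A => dot c (std_sum R A)) BM) => A AM minA.
by exists A.
Qed.

(* Exchange out an element of largest weight in the symmetric difference: the
   element coming in is no heavier, so the new basis is again minimal. *)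
Lemma min_basis_exchange c M A B : min_basis c M A -> min_basis c M B ->
  A != B -> exists C x y, [/\ min_basis c M C, min_basis c M (y |: (C :\ x)),
    x \in C & y \notin C].
Proof.
move=> mA mB AB.
have /set0Pn[x0 x0D] : (A :\: B) :|: (B :\: A) != finset.set0.
  by rewrite setU_eq0 !setD_eq0 -eqEsubset.
case: (arg_maxP (fun x => c 0 x) x0D) => x xD maxx.
(* The heaviest element may lie in either basis; the conclusion does not mention [A] or [B], so they
   can be swapped. *)
wlog xA : A B mA mB AB x0D xD maxx / x \in A :\: B.
  move=> th; have /setUP[xA|xB] := xD; first exact: th xA.
  by apply: (th B A) => //; rewrite 1?eq_sym // setUC.
have [[AM minA] [BM minB]] := (mA, mB).
have [y yBA A'M] := bases_exchange AM BM xA.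
have [xinA yninA] : x \in A /\ y \notin A.
  by move: xA yBA; rewrite !inE => /andP[_ ->] /andP[->].
exists A, x, y; split => //; split => // C /minA; apply: le_trans.
have /(congr1 (dot c)) := std_sum_exchange R xinA yninA.
have yx : c 0 y <= c 0 x by apply: maxx; apply/setUP; right.
rewrite !dot_std_sum; rewrite (big_setD1 x xinA) big_setU1 /=; last first.
  by rewrite !inE (negbTE yninA) andbF.
by move=> _; rewrite lerD2r.
Qed.
End MinBasis.

(** * Faces, vertices and edges of the flag matroid polytope *)

Section Flag.
Variables (R : realType) (n k : nat) (M : 'I_k -> matroid n).
Implicit Types (c : 'rV[R]_n) (B : 'I_k -> {set 'I_n}).
Let P := flag_matroid_polytope R M.

Lemma flag_polytope_point B : (forall i, B i \in bases (M i)) ->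
  P (\sum_i std_sum R (B i)).
Proof.
move=> BM; exists (fun i => std_sum R (B i)) => // i.
by apply: sub_convex_hull; exists (B i) => //; exact: BM.
Qed.

(** A half-space is convex, so a bound on the bases holds on each matroid polytope; the bounds add
    over the summands. *)
Lemma flag_dot_ge c (m : 'I_k -> R) x :
  (forall i (A : {set 'I_n}), A \in bases (M i) -> m i <= dot c (std_sum R A)) ->
  P x ->
  \sum_i m i <= dot c x.
Proof.
move=> mle [y Py <-]; rewrite dot_sum ler_sum // => i _.
have sub : (matroid_polytope R (M i) `<=` [set x | (m i <= dot c x)%R])%classic.
  apply: convex_hull_sub; first exact: convex_dot_ge.
  by move=> _ [B BM <-]; exact: mle.
exact: sub (Py i).
Qed.

(** The points satisfying the conclusion form a convex set: a proper convex combination takes the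
    minimal value only if both end points do, and both are then the same vertex. *)
Lemma matroid_dot_eq c (N : matroid n) A x : min_basis c N A ->
  (forall A', min_basis c N A' -> A' = A) -> matroid_polytope R N x ->
  dot c (std_sum R A) <= dot c x /\ (dot c x = dot c (std_sum R A) -> x = std_sum R A).
Proof.
move=> [AN minA] uniqA; set m := dot c _.
apply: (@convex_hull_sub _ _ _ [set x | m <= dot c x /\ (dot c x = m -> x = std_sum R A)]%classic).
  apply/convex_setP => y z t /andP[t0 t1] [my eqy] [mz eqz] /=.
  rewrite dotD !dotZ; split; first by nra.
  move=> eqm.
  have [t00|tn0] := eqVneq t 0.
    by move: eqm; rewrite t00 mul0r !(scale0r, add0r, subr0, scale1r) mul1r; exact: eqz.
  have [t11|tn1] := eqVneq t 1.
    by move: eqm; rewrite t11 subrr mul0r !(scale0r, addr0, scale1r) mul1r; exact: eqy.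
  have t_gt0 : 0 < t by rewrite lt_neqAle eq_sym tn0.
  have t_lt1 : t < 1 by rewrite lt_neqAle tn1.
  have -> : y = std_sum R A by apply: eqy; nra.
  have -> : z = std_sum R A by apply: eqz; nra.
  by rewrite -scalerDl addrC subrK scale1r.
move=> _ [B BN <-]; split; first exact: minA.
by move=> eqB; rewrite (uniqA B) //; split=> // C /minA; rewrite eqB.
Qed.

Lemma face_min c m B :
  (forall x, P x -> m <= dot c x) -> (exists2 x, P x & dot c x = m) ->
  (forall i, min_basis c (M i) (B i)) -> m = dot c (\sum_i std_sum R (B i)).
Proof.
move=> lem [x Px xm] minB; apply/eqP; rewrite eq_le lem /=; last first.
  by apply: flag_polytope_point => i; have [] := minB i.
rewrite -xm dot_sum; apply: flag_dot_ge Px => i C CM.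
by have [_ /(_ C CM)] := minB i.
Qed.

Lemma face_point c m B :
  (forall x, P x -> m <= dot c x) -> (exists2 x, P x & dot c x = m) ->
  (forall i, min_basis c (M i) (B i)) ->
  [set x | P x /\ dot c x = m]%classic (\sum_i std_sum R (B i)).
Proof.
move=> lem ex minB; split; last by rewrite (face_min lem ex minB).
by apply: flag_polytope_point => i; have [] := minB i.
Qed.

(** Each summand is at least its minimum and the totals agree, so every summand attains its minimum,
    which happens at one point only. *)
Lemma face_unique c m B x :
  (forall x, P x -> m <= dot c x) -> P x -> dot c x = m ->
  (forall i, min_basis c (M i) (B i)) ->
  (forall i A, min_basis c (M i) A -> A = B i) -> x = \sum_i std_sum R (B i).
Proof.
move=> lem Px xm minB uniqB.
have := face_min lem (ex_intro2 _ _ x Px xm) minB; rewrite -{}xm.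
case: Px => y Py <-; rewrite !dot_sum => eqd.
have H i := matroid_dot_eq (minB i) (uniqB i) (Py i).
apply: eq_bigr => i _; apply: (H i).2; apply/eqP; rewrite eq_le (H i).1 andbT.
have := eqd; rewrite (bigD1 i) //= [RHS](bigD1 i) //= => /eqP.
have : \sum_(j | j != i) dot c (std_sum R (B j)) <= \sum_(j | j != i) dot c (y j).
  by apply: ler_sum => j _; exact: (H j).1.
by move=> + /eqP; lra.
Qed.

Lemma flag_min_bases c : exists B, forall i, min_basis c (M i) (B i).
Proof. have /boolp.choice[B minB] i := min_basis_exists c (M i).
by exists B. Qed.

(** A vertex is a one-point face, and a nonempty face contains a sum of indicator vectors of minimal
    bases. *)
Lemma flag_polytope_vertex_int v : is_vertex P v -> forall i, v 0 i \is a Num.int.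
Proof.
move=> [c [m [lem vE]]] i; have [B minB] := flag_min_bases c.
have [Pv vm] : [set x | P x /\ dot c x = m]%classic v by rewrite -[X in X v]vE.
have := face_point lem (ex_intro2 _ _ v Pv vm) minB; rewrite -[X in X _]vE => <-.
by rewrite summxE rpred_sum // => j _; exact: std_sum_int.
Qed.

(** If every [M i] had a unique minimal basis, the face would be a point. So some [M i] has two, and
    hence two that differ by one exchange. Changing only the summand [i] gives two points of the
    edge whose difference is [std R y - std R x]. *)
Lemma flag_polytope_edge u v : is_edge P u v ->
  exists (i j : 'I_n) (t : R), i != j /\ v - u = t *: (std R i - std R j).
Proof.
move=> [uv [c [m [lem eF]]]]; have [B minB] := flag_min_bases c.
have [Pu um] : [set x | P x /\ dot c x = m]%classic u.
  by rewrite -[X in X u]eF; apply: sub_convex_hull; left.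
have [Pv vm] : [set x | P x /\ dot c x = m]%classic v.
  by rewrite -[X in X v]eF; apply: sub_convex_hull; right.
have [i [A [mA AB]]] : exists i A, min_basis c (M i) A /\ A != B i.
  apply: contrapT => nex; apply: uv.
  have uniqB i A : min_basis c (M i) A -> A = B i.
    by move=> mA; apply: contrapT => AB; apply: nex; exists i, A; split=> //; apply/eqP.
  by rewrite (face_unique lem Pu um minB uniqB) (face_unique lem Pv vm minB uniqB).
have [C [x [y [mC mC' xC yC]]]] := min_basis_exchange mA (minB i) AB.
pose upd D j := if j == i then D else B j.
have updP D : min_basis c (M i) D -> forall j, min_basis c (M j) (upd D j).
  by move=> mD j; rewrite /upd; case: eqP => [->|_].
have seg D : min_basis c (M i) D ->
    exists t, \sum_j std_sum R (upd D j) = u + t *: (v - u).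
  move=> /updP mD; apply: convex_hull2.
  by rewrite [X in X _]eF; apply: face_point mD => //; exists u.
have [t tE] := seg _ mC; have [s sE] := seg _ mC'.
have : (s - t) *: (v - u) = std R y - std R x.
  rewrite -(std_sum_exchange R xC yC) scalerBl.
  rewrite -[s *: _](addKr u) -[t *: _](addKr u) -sE -tE opprD opprK addrACA addNr add0r.
  rewrite (bigD1 i) //= [X in _ - X](bigD1 i) //= /upd eqxx opprD addrACA.
  rewrite [X in _ + X](_ : _ = 0) ?addr0 //; apply/eqP; rewrite subr_eq0; apply/eqP.
  by apply: eq_bigr => j /negbTE ->.
have yx : y != x by apply: contraNneq yC => ->.
(* Equal parameters would give [std R y = std R x], against [y != x]. *)
have [->|st] := eqVneq s t.
  rewrite subrr scale0r => /esym/eqP; rewrite subr_eq0 => /eqP/std_inj eyx.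
  by rewrite eyx eqxx in yx.
move=> st_vu; exists y, x, (s - t)^-1; split=> //.
by rewrite -st_vu scalerA mulVf ?scale1r // subr_eq0.
Qed.

Lemma flag_polytope_polytope : polytope P.
Proof.
pose V := [set \sum_i std_sum R (B i) | B in
  [set` [pred B : {ffun 'I_k -> {set 'I_n}} | [forall i, B i \in bases (M i)]]]]%classic.
exists V; split.
- exact/finite_image/finite_finpred.
(* The zero form serves only to pick some basis of each matroid. *)
- have [B BM] := flag_min_bases 0.
  exists (\sum_i std_sum R ([ffun i => B i] i)), [ffun i => B i] => //=.
  by apply/forallP => i; rewrite ffunE; have [] := BM i.
apply/seteqP; split=> x.
  move=> [y Py <-] C [cC VC].
  (* Replace the vertices by arbitrary points one summand at a time. *)
  suff hyb m : forall B, (forall i, B i \in bases (M i)) ->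
      C (\sum_(i < k) if (i < m)%N then y i else std_sum R (B i)).
    have [B BM] := flag_min_bases 0.
    have := hyb k B (fun i => (BM i).1).
    by rewrite (eq_bigr y) // => i _; rewrite ltn_ord.
  elim: m => [|m IHm] B BM.
    apply: VC; exists [ffun i => B i].
      by apply/forallP => i; rewrite ffunE; exact: BM.
    by apply: eq_bigr => i _; rewrite ffunE.
  have [ltmk|lekm] := ltnP m k; last first.
    have := IHm B BM; congr C; apply: eq_bigr => i _.
    by have := ltn_ord i => ?; rewrite !ifT //; lia.
  pose j := Ordinal ltmk.
  pose rest := \sum_(i < k | i != j) if (i < m)%N then y i else std_sum R (B i).
  have restE z D : D = z -> \sum_(i < k) (if (i < m)%N then y i else
       if i == j then D else std_sum R (B i)) = z + rest.
    move=> ->; rewrite (bigD1 j) //= ltnn eqxx; congr (_ + _).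
    by apply: eq_bigr => i /negbTE ->.
  (* The translate of [C] by [- rest] is convex and contains the vertices of the summand [j], hence
     also [y j]. *)
  have : [set z | C (z + rest)]%classic (y j).
    move: (y j) (Py j); apply: convex_hull_sub.
      apply/convex_setP => a b t t01 Ca Cb /=.
      have := (convex_setP C).1 cC _ _ t t01 Ca Cb; congr C.
      rewrite !scalerDr addrACA -scalerDl; congr (_ + _).
      by rewrite addrC subrK scale1r.
    move=> _ [D DM <-] /=; rewrite -(restE _ _ erefl).
    have := IHm (fun i => if i == j then D else B i); rewrite (eq_bigr (fun i : 'I_k =>
       if (i < m)%N then y i else if i == j then std_sum R D else std_sum R (B i))).
      by apply=> i; case: eqP => [->|].
    by move=> i _; case: (i == j).
  rewrite /=; congr C; rewrite [RHS](bigD1 j) //= ltnSn; congr (_ + _).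
  apply: eq_bigr => i ij; have im : i <> m :> nat.
    by move=> im; move/eqP: ij; apply; exact: val_inj.
  by have -> : (i < m.+1)%N = (i < m)%N by lia.
apply: convex_hull_sub.
  apply/convex_setP => _ _ t t01 [y Py <-] [z Pz <-].
  exists (fun i => t *: y i + (1 - t) *: z i).
    move=> i; have /convex_setP cP := @convex_convex_hull R n
      [set std_sum R A | A in [set A | A \in bases (M i)]]%classic.
    exact: (cP _ _ t t01 (Py i) (Pz i)).
  by rewrite big_split /= !scaler_sumr.
by move=> _ [B /forallP BM <-]; exact: flag_polytope_point.
Qed.

Lemma flag_polytope_lattice_gp : lattice_gp P.
Proof.
split; last exact: flag_polytope_vertex_int.
by split; [exact: flag_polytope_polytope|exact: flag_polytope_edge].
Qed.
End Flag.


(** * The supermodular function and the MV condition in terms of ranks *)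

Lemma sum_maxnE (R : realType) (K : R) (p q r s t u : nat) :
  K - p%:R + (K - q%:R) =
    Num.min (K - r%:R + (K - s%:R)) (K - t%:R + (K - u%:R)) <->
  (p + q = maxn (r + s) (t + u))%N.
Proof.
have E (v w : nat) : K - v%:R + (K - w%:R) = K + K - (v + w)%:R.
  by rewrite natrD; ring.
rewrite !{}E; have -> : Num.min (K + K - (r + s)%:R) (K + K - (t + u)%:R)
    = K + K - (maxn (r + s) (t + u))%:R.
  have [le|/ltnW le] := leqP (r + s) (t + u).
    by rewrite min_r // lerD2l lerN2 ler_nat.
  by rewrite min_l // lerD2l lerN2 ler_nat.
split=> [/addrI/oppr_inj/eqP|->//]; by rewrite eqr_nat => /eqP.
Qed.

(** All bases of a matroid have the same size, so minimizing [#|S :&: A|] over them means maximizing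
    [#|~: S :&: A|]. The minimum over a Minkowski sum is reached in each summand independently. *)
Lemma supermod_flag (R : realType) (n k : nat) (M : 'I_k -> matroid n)
    (S : {set 'I_n}) :
  supermod (flag_matroid_polytope R M) S =
  (\sum_i mrank (M i) [set: 'I_n])%:R - (\sum_i mrank (M i) (~: S))%:R.
Proof.
pose c : 'rV[R]_n := \row_i (i \in S)%:R.
have dotE x : dot c x = \sum_(i in S) x 0 i.
  rewrite [RHS]big_mkcond; apply: eq_bigr => i _.
  by rewrite mxE; case: ifP; rewrite ?mul1r ?mul0r.
have dotB (A : {set 'I_n}) : dot c (std_sum R A) = #|S :&: A|%:R.
  rewrite dot_std_sum (eq_bigr (fun i => if i \in S then 1 else 0)); last first.
    by move=> i _; rewrite mxE; case: (i \in S).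
  rewrite -big_mkcondr sumr_const; congr _%:R; apply: eq_card => i.
  by rewrite !inE andbC.
have cardB i (A : {set 'I_n}) : A \in bases (M i) ->
    (#|S :&: A| = mrank (M i) [set: 'I_n] - #|~: S :&: A|)%N.
  move=> AM; have [A' A'M ->] := mrank_attained (M i) [set: 'I_n].
  rewrite setTI (card_bases A'M AM) -(cardsID S A) setDE.
  by rewrite (setIC A S) (setIC A) addnK.
rewrite -natrB; last by apply: leq_sum => i _; rewrite mrankS ?subsetT.
rewrite -sumnB; last by move=> i _; rewrite mrankS ?subsetT.
rewrite natr_sum /supermod /minimum; set m := \sum_i _; set V := classical_sets.image _ _.
have Vm : V m.
  have ex i : exists A, A \in bases (M i) /\ mrank (M i) (~: S) = #|~: S :&: A|.
    by have [A AM rA] := mrank_attained (M i) (~: S); exists A.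
  have {ex} /boolp.choice[B BP] := ex.
  exists (\sum_i std_sum R (B i)).
    by apply: flag_polytope_point => i; have [] := BP i.
  rewrite -dotE dot_sum; apply: eq_bigr => i _; have [BM ->] := BP i.
  by rewrite dotB (cardB i).
have lbm : lbound V m.
  move=> _ [x Px <-]; rewrite -dotE; apply: flag_dot_ge Px => i A AM.
  by rewrite dotB (cardB i) // ler_nat leq_sub2l // leq_mrank.
apply: xget_unique => // y [Vy lby].
by apply/eqP; rewrite eq_le lby // lbm.
Qed.

(** Complementation turns [S] with some of [a], [b], [c] added into [D] with the others added, and
    the minimum into a maximum. The family is arbitrary, so a single matroid is an instance. *)
Lemma mv_flag_iff (R : realType) (n k : nat) (M : 'I_k -> matroid n) :
  mv_polytope (flag_matroid_polytope R M) <->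
  forall (S : {set 'I_n}) (a b c : 'I_n),
    a \notin S -> b \notin S -> c \notin S -> (a < b)%N -> (b < c)%N ->
    let D := ~: (S :|: [set a; b; c]) in
    (\sum_i mrank_split (M i) D b a c =
     maxn (\sum_i mrank_split (M i) D a b c) (\sum_i mrank_split (M i) D c a b))%N.
Proof.
have compl (S : {set 'I_n}) a b c : a \notin S -> b \notin S -> c \notin S ->
    (a < b)%N -> (b < c)%N ->
    let D := ~: (S :|: [set a; b; c]) in
    [/\ ~: (S :|: [set a]) = D :|: [set b; c], ~: (S :|: [set b]) = D :|: [set a; c]
      & ~: (S :|: [set c]) = D :|: [set a; b]] /\
    [/\ ~: (S :|: [set a; b]) = D :|: [set c], ~: (S :|: [set b; c]) = D :|: [set a]
      & ~: (S :|: [set a; c]) = D :|: [set b]].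
  move=> aS bS cS ab bc D.
  have [nab nbc nac] : [/\ a != b, b != c & a != c].
    by split; rewrite -val_eqE /= neq_ltn ?ab ?bc ?(ltn_trans ab bc).
  split; split; apply/setP => x; rewrite !inE;
    (have [->|_] := eqVneq x a;
      first by rewrite (negbTE aS) ?(negbTE nab) ?(negbTE nac));
    (have [->|_] := eqVneq x b; first by rewrite (negbTE bS) ?(negbTE nbc));
    (have [->|_] := eqVneq x c; first by rewrite (negbTE cS));
    by rewrite !orbF.
have split_sum (D : {set 'I_n}) x y z : (\sum_i mrank_split (M i) D x y z =
    \sum_i mrank (M i) (D :|: [set x]) + \sum_i mrank (M i) (D :|: [set y; z]))%N.
  by rewrite -big_split.
split=> [[_ mv]|mv].
  move=> S a b c aS bS cS ab bc D; have := mv S a b c aS bS cS ab bc.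
  rewrite !supermod_flag; have [[-> -> ->] [-> -> ->]] := compl S a b c aS bS cS ab bc.
  move/sum_maxnE; rewrite !split_sum -/D => e.
  by rewrite addnC e addnC [X in maxn _ X]addnC.
split; first exact: flag_polytope_lattice_gp.
move=> S a b c aS bS cS ab bc; have := mv S a b c aS bS cS ab bc.
rewrite !supermod_flag; have [[-> -> ->] [-> -> ->]] := compl S a b c aS bS cS ab bc.
rewrite /= !split_sum => e; apply/sum_maxnE.
by rewrite addnC e addnC [X in maxn _ X]addnC.
Qed.

(** Allows [mv_flag_iff] to be applied to one matroid, as a family of length one. *)
Lemma flag_matroid_polytope1 (R : realType) n (N : matroid n) :
  flag_matroid_polytope R (fun _ : 'I_1 => N) = matroid_polytope R N.
Proof.
apply/seteqP; split=> [_ [x Nx <-]|x Nx]; first by rewrite big_ord1; exact: Nx.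
by exists (fun=> x) => //; rewrite big_ord1.
Qed.

Theorem theorem2 (R : realType) (n k : nat) (M : 'I_k -> matroid n)
    (hk : (0 < k)%N) (hM : flag_matroid M) :
  mv_polytope (flag_matroid_polytope R M) <->
  (forall i : 'I_k, mv_polytope (matroid_polytope R (M i))).
Proof.
(* For fixed [S], [a], [b], [c] the condition on the sums is equivalent to the same condition on
   every [M i]. *)
have local S a b c := sum_max_iff
  (fun i => mrank_split_max_twice (M i) (~: (S :|: [set a; b; c])) a b c)
  (fun i j => @flag_split n k M i j (~: (S :|: [set a; b; c])) a b c hM).
split=> [/mv_flag_iff mv i|mv].
  rewrite -flag_matroid_polytope1; apply/mv_flag_iff => S a b c aS bS cS ab bc D.
  by rewrite !big_ord1; apply: (local S a b c).1; exact: mv.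
apply/mv_flag_iff => S a b c aS bS cS ab bc D; apply/local => i.
have := mv i; rewrite -flag_matroid_polytope1 => /mv_flag_iff/(_ S a b c aS bS cS ab bc).
by rewrite /= !big_ord1.
Qed.
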